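(* Let $a,b,c\in\mathbb{R}$, $\lambda>0$, and assume $l:=2a+b^2+\lambda c(2+c)<0$. Then the semi-tamed scheme with step size $\Delta t>0$ applied to the linear equation $dX(t)=aX(t^-)dt+bX(t^-)dW(t)+cX(t^-)dN(t)$, $X(0)=X_0$, that is, $$Y_{n+1}=Y_n+aY_n\Delta t+bY_n\Delta W_n+cY_n\Delta N_n,\qquad Y_0=X_0,$$ is mean-square stable if and only if $$\Delta t<\frac{-l}{(a+\lambda c)^2}.$$
   Context: $W$ is a scalar Brownian motion and $N$ a scalar Poisson process with parameter $\lambda$, independent of each other and of $X_0$, where $X_0$ is a real random variable with $\mathbb{E}|X_0|^2<\infty$. $t_n=n\Delta t$, $\Delta W_n=W(t_{n+1})-W(t_n)$, $\Delta N_n=N(t_{n+1})-N(t_n)$. The semi-tamed scheme for a drift split as $f=u+v$ tames only $v$; for the linear equation $u(x)=ax$ and $v=0$, which gives the displayed recursion. The scheme is called mean-square stable if (given $l<0$) $\lim_{n\to\infty}\mathbb{E}(Y_n^2)=0$ for every such initial value $X_0$. *)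

(* Defs.v *)
#[local] Set Warnings "-notation-overridden,-notation-incompatible-prefix".
From HB Require Import structures.
From mathcomp Require Import all_boot all_order all_algebra finmap.
From mathcomp Require Import all_classical all_reals all_analysis.
Set Implicit Arguments.
Unset Strict Implicit.
Unset Printing Implicit Defensive.
Import Order.TTheory GRing.Theory Num.Theory.
Import numFieldNormedType.Exports.
Local Open Scope classical_set_scope.
Local Open Scope ring_scope.

Section independence.
Context d (T : measurableType d) (R : realType) (P : probability T R).

(* Product rule over every finite subfamily. *)
Definition mutually_independent (I : choiceType)
    (F : I -> set_system T) : Prop :=
  forall (J : {fset I}) (A : I -> set T), (forall i, i \in J -> F i (A i)) ->
    P (\bigcap_(i in [set` J]) A i) = (\prod_(i <- J) P (A i))%E.

Definition independent_RVs (I : choiceType) (X : I -> T -> R) : Prop :=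
  mutually_independent (fun i => g_sigma_algebra_preimage (X i)).

End independence.

Section processes.
Context d (T : measurableType d) (R : realType) (P : probability T R).

(* Processes are indexed by all of R for convenience: nothing is ever assumed
   about, or used from, strictly negative times. *)
Implicit Type X : R -> {RV P >-> R}.

Definition increment X (s t : R) (w : T) : R := X t w - X s w.

Definition sigma_process X : set_system T :=
  <<s \bigcup_(t in [set t : R | 0 <= t]) g_sigma_algebra_preimage (X t) >>.

Definition independent_increments X : Prop :=
  forall t : nat -> R, 0 <= t 0%N ->
    {homo t : i j / (i <= j)%N >-> i <= j} ->
    independent_RVs P (fun i => increment X (t i) (t i.+1)).

(* The second parameter of [normal_prob] is the standard deviation. *)
Definition brownian_motion (W : R -> {RV P >-> R}) : Prop :=
  [/\ {ae P, forall w, W 0 w = 0},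
      independent_increments W,
      forall s t : R, 0 <= s -> s < t -> forall A : set R, measurable A ->
        P (increment W s t @^-1` A) = normal_prob 0 (Num.sqrt (t - s)) A &
      {ae P, forall w, {within `[0, +oo[, continuous (fun t => W t w)}}].

Definition counting_path (x : R -> R) : Prop :=
  [/\ forall t, 0 <= t -> x t \is a Num.nat,
      forall s t, 0 <= s -> s <= t -> x s <= x t &
      forall t, 0 <= t -> x s @[s --> t^'+] --> x t].

Definition poisson_process (lambda : R) (N : R -> {RV P >-> R}) : Prop :=
  [/\ {ae P, forall w, N 0 w = 0},
      independent_increments N,
      forall s t : R, 0 <= s -> s < t -> forall k : nat,
        P (increment N s t @^-1` [set k%:R]) =
          (poisson_pmf (lambda * (t - s)) k)%:E &
      {ae P, forall w, counting_path (fun t => N t w)}].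

End processes.

Section scheme.
Context d (T : measurableType d) (R : realType) (P : probability T R).

(* Drift split as u + v with u x = a x and v = 0: since only v is tamed, no
   taming factor appears. *)
Fixpoint semi_tamed_linear (a b c dt : R) (W N : R -> {RV P >-> R})
    (X0 : T -> R) (n : nat) (w : T) : R :=
  if n is m.+1 then
    let y := semi_tamed_linear a b c dt W N X0 m w in
    y + a * y * dt + b * y * increment W (m%:R * dt) (m.+1%:R * dt) w
      + c * y * increment N (m%:R * dt) (m.+1%:R * dt) w
  else X0 w.

(* Admissible initial values: square integrable, with X0, W, N independent. *)
Definition initial_value (W N : R -> {RV P >-> R}) (X0 : {RV P >-> R}) : Prop :=
  ('E_P[fun w => (`|X0 w| ^+ 2)%R] < +oo)%E /\
  mutually_independent P (tnth [tuple g_sigma_algebra_preimage X0;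
                                      sigma_process W; sigma_process N]).

Definition mean_square_stable (W N : R -> {RV P >-> R})
    (Y : (T -> R) -> nat -> T -> R) : Prop :=
  forall X0 : {RV P >-> R}, initial_value W N X0 ->
    'E_P[fun w => (Y X0 n w ^+ 2)%R]%E @[n --> \oo] --> 0%E.

End scheme.

(* Main.v *)
(* Writing Y_(n+1) = Y_n (1 + a dt + b dW_n + c dN_n), the factor is independent
   of Y_n, so E Y_n^2 = r^n E X0^2 where
     r = (1 + (a + lambda c) dt)^2 + b^2 dt + c^2 lambda dt
       = 1 + dt (l + (a + lambda c)^2 dt)
   is the second moment of the factor; the assumption l < 0 forces
   a + lambda c <> 0.  Stability is thus r < 1, the initial value X0 = 1 giving
   necessity.  Independence is propagated by induction on n: Y_n is independent
   of all cylinder events in the increments from index n on.  The second moment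
   of the factor is computed by integrating first in the Gaussian variable, which
   avoids any integrability question for the cross term dW_n dN_n. *)
Require Import Defs.
From HB Require Import structures.
From mathcomp Require Import all_boot all_order all_algebra finmap.
From mathcomp Require Import all_classical all_reals all_analysis.
From mathcomp Require Import measurable_realfun ring.
Import Order.TTheory GRing.Theory Num.Theory.
Import numFieldNormedType.Exports.
Local Open Scope classical_set_scope.
Local Open Scope ring_scope.

(** * Second moment of an affine function of a centred Gaussian *)

Section normal_moments.
Context (R : realType).
Notation mu := (@lebesgue_measure R).
Local Open Scope ereal_scope.

(** The normal law is absolutely continuous, and its Radon-Nikodym derivative agrees almost
    everywhere with [normal_pdf] because both have the same integral over every measurable set. *)
Lemma ge0_integral_normal_prob (m s : R) (f : R -> \bar R) :
  (forall x, 0 <= f x) -> measurable_fun [set: R] f ->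
  \int[normal_prob m s]_x f x = \int[mu]_x (f x * (normal_pdf m s x)%:E).
Proof.
move=> f0 mf.
have dom := normal_prob_dominates m s.
rewrite -(Radon_Nikodym_SigmaFinite.change_of_variables dom)//.
have ig := Radon_Nikodym_SigmaFinite.f_integrable dom.
apply: ae_eq_integral => //.
- by apply: emeasurable_funM => //; exact: measurable_int ig.
- apply: emeasurable_funM => //; apply/measurable_EFinP.
  exact: measurable_normal_pdf.
suff : ae_eq mu setT (Radon_Nikodym_SigmaFinite.f (normal_prob m s) mu)
    (fun x => (normal_pdf m s x)%:E).
  by apply: filterS => x + _ /= => /(_ I) ->.
apply: integral_ae_eq => //.
  exact: measurable_int (integrable_normal_pdf m s).
by move=> A _ mA; rewrite -Radon_Nikodym_SigmaFinite.f_integral.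
Qed.

(** Split the line at 0 and substitute [- x] on the negative half. This reduces to [[0, +oo[], where
    integrals are limits of integrals over [[0, n]]. *)
Lemma ge0_integralT_fold (f : R -> R) :
  (forall x, (0 <= f x)%R) -> continuous f ->
  \int[mu]_x (f x)%:E = \int[mu]_(x in `[0%R, +oo[) (f x)%:E
                      + \int[mu]_(x in `[0%R, +oo[) (f (- x))%:E.
Proof.
move=> f0 cf.
have mf : measurable_fun [set: R] f by exact: continuous_measurable_fun.
rewrite -(setUv `[0%R, +oo[) ge0_integral_setU//=; last 4 first.
- exact: measurableC.
- by apply/measurable_EFinP; rewrite setUv.
- by move=> x _; rewrite lee_fin.
- exact/disj_setPCl.
congr +%E.
rewrite setCitvr integral_itv_bndo_bndc; last first.
  exact/measurable_EFinP/measurable_funTS.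
rewrite -{1}oppr0 ge0_integration_by_substitutionNy//.
exact: continuous_subspaceT.
Qed.

Lemma ge0_integralT_oppr (f : R -> R) :
  (forall x, (0 <= f x)%R) -> continuous f ->
  \int[mu]_x (f (- x))%:E = \int[mu]_x (f x)%:E.
Proof.
move=> f0 cf; rewrite ge0_integralT_fold//; last first.
  move=> x; apply: (@continuous_comp _ _ _ (-%R : R -> R) f); last exact: cf.
  exact: oppr_continuous.
rewrite [RHS]ge0_integralT_fold// addeC.
by congr +%E; apply: eq_integral => x _; rewrite opprK.
Qed.

Lemma is_derive_normal_pdf (s x : R) : (s != 0)%R ->
  is_derive x 1%R (normal_pdf 0%R s) (- x / s ^+ 2 * normal_pdf 0%R s x)%R.
Proof.
move=> s0; rewrite normal_pdfE// /normal_fun.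
have s20 : (s ^+ 2 != 0)%R by rewrite expf_neq0.
apply: is_derive_eq.
rewrite /GRing.scale/=.
by field.
Qed.

(** This is the vanishing boundary term of the integration by parts below. With [u = x^2 / (2 s^2)],
    the crude bound [exp (- u) <= 1 / u] already makes [x] times the density at most a constant over
    [x]. *)
Lemma cvg_mulr_normal_pdf (s : R) : (s != 0)%R ->
  (n.+1%:R * normal_pdf 0%R s n.+1%:R)%R @[n --> \oo] --> 0%R.
Proof.
move=> s0; have s20 : (0 < s ^+ 2)%R by rewrite exprn_even_gt0.
have h0 : (normal_peak s * (s ^+ 2 *+ 2) * harmonic n)%R @[n --> \oo] --> 0%R.
  rewrite -[X in _ --> X](mulr0 (normal_peak s * (s ^+ 2 *+ 2))%R).
  by apply: cvgM; [exact: cvg_cst|exact: cvg_harmonic].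
apply: (squeeze_cvgr _ (cvg_cst 0%R) h0).
apply: nearW => n /=; rewrite mulr_ge0 ?normal_pdf_ge0//=.
rewrite normal_pdfE// /normal_fun subr0 mulNr expRN mulrCA -mulrA.
rewrite ler_wpM2l ?normal_peak_ge0//.
set u := (_ / (s ^+ 2 *+ 2))%R.
have u0 : (0 < u)%R by rewrite divr_gt0 ?pmulrn_lgt0 ?(@exprn_gt0 _ n.+1%:R).
have uE : ((expR u)^-1 <= u^-1)%R.
  by rewrite lef_pV2 ?posrE ?expR_gt0// (le_trans _ (expR_ge1Dx _))// lerDr.
rewrite (le_trans (ler_wpM2l _ uE))// /u invfM invrK.
rewrite le_eqVlt; apply/orP; left; apply/eqP.
have : (n.+1%:R != 0 :> R)%R by rewrite pnatr_eq0.
by move=> ?; field.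
Qed.

(** Integrate by parts on [[0, n + 1]], writing the integrand as [x] times [x * f x], and let [n] go
    to infinity. *)
Lemma integral_sqr_normal_pdf_0y (s : R) : (s != 0)%R ->
  \int[mu]_(x in `[0%R, +oo[) (x ^+ 2 * normal_pdf 0%R s x)%:E =
  (s ^+ 2)%:E * \int[mu]_(x in `[0%R, +oo[) (normal_pdf 0%R s x)%:E.
Proof.
move=> s0; set f := normal_pdf 0%R s.
have s20 : (s ^+ 2 != 0)%R by rewrite expf_neq0.
have df (x : R) : is_derive x 1%R f (- x / s ^+ 2 * f x)%R.
  exact: is_derive_normal_pdf.
have cf : continuous f by exact: continuous_normal_pdf.
have mf : measurable_fun [set: R] f by exact: measurable_normal_pdf.
have f0 x : (0 <= f x)%R by exact: normal_pdf_ge0.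
have cX2 : continuous (fun x : R => x ^+ 2)%R by exact: exprn_continuous.
have m2 : measurable_fun [set: R] (fun x => x ^+ 2 * f x)%R.
  by apply: measurable_funM => //; exact: continuous_measurable_fun.
have c1 := @ge0_cvgn_integral R mu (fun x => x ^+ 2 * f x)%R
  (fun x => mulr_ge0 (sqr_ge0 x) (f0 x)) m2.
have c2 := @ge0_cvgn_integral R mu f f0 mf.
have fin : \int[mu]_(x in `[0%R, +oo[) (f x)%:E \is a fin_num.
  rewrite ge0_fin_numE; last by apply: integral_ge0 => x _; rewrite lee_fin.
  apply: (@le_lt_trans _ _ (\int[mu]_x (f x)%:E)).
    apply: ge0_subset_integral => //; first exact/measurable_EFinP.
    by move=> x _; rewrite lee_fin.
  by rewrite integral_normal_pdf ltry.
(* Since [f' = - x / s^2 * f], this is an antiderivative of [x * f x]. *)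
pose G := (fun x => - (s ^+ 2) * f x)%R.
have dG (x : R) : is_derive x 1%R G (x * f x)%R.
  apply: is_derive_eq; rewrite /GRing.scale/=.
  by field.
have dL (H h : R -> R) (a b : R) : (forall x : R, is_derive x 1%R H (h x)) ->
    derivable_oo_LRcontinuous H a b.
  move=> dH; have cH : continuous H.
    by move=> x; apply: differentiable_continuous; apply/derivable1_diffP; case: (dH x).
  split; first by move=> x _; case: (dH x).
  - by apply: cvg_at_right_filter; exact: cH.
  - by apply: cvg_at_left_filter; exact: cH.
have parts n : \int[mu]_(x in `[0%R, n.+1%:R]) (x ^+ 2 * f x)%:E =
    (- (s ^+ 2) * (n.+1%:R * f n.+1%:R))%:E +
    (s ^+ 2)%:E * \int[mu]_(x in `[0%R, n.+1%:R]) (f x)%:E.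
  under eq_integral do rewrite expr2 -mulrA.
  rewrite (@integration_by_parts _ idfun G (cst 1%R) (fun x => x * f x)%R)//.
  - rewrite mul0r subr0 mulrCA; congr (_ + _).
    under eq_integral do rewrite /G mul1r mulNr EFinN EFinM.
    rewrite integral_ge0N; last by move=> x _; rewrite mule_ge0 ?lee_fin ?sqr_ge0.
    rewrite oppeK ge0_integralZl ?lee_fin ?sqr_ge0//.
      exact/measurable_EFinP/measurable_funTS.
    by move=> x _; rewrite lee_fin.
  - exact/continuous_subspaceT/cst_continuous.
  - by apply: (dL _ (cst 1%R)) => x; exact: is_derive_id.
  - by move=> x _; rewrite derive1E derive_id.
  - apply: continuous_subspaceT => x.
    by apply: continuousM; [exact: cvg_id|exact: cf].
  - exact: dL dG.
  - by move=> x _; rewrite derive1E derive_val.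
have cn := cvg_mulr_normal_pdf s s0.
pose I (g : R -> R) n := \int[mu]_(x in `[0%R, n%:R]) (g x)%:E.
have c2' : I f n.+1 @[n --> \oo] --> \int[mu]_(x in `[0%R, +oo[) (f x)%:E.
  by move: c2; rewrite -cvg_shiftS.
have c1' : I (fun x => x ^+ 2 * f x)%R n.+1 @[n --> \oo] -->
    (s ^+ 2)%:E * \int[mu]_(x in `[0%R, +oo[) (f x)%:E.
  rewrite -[X in _ --> X]add0e (funext parts : (fun n => I _ n.+1) = _).
  apply: cvgeD.
  - by rewrite fin_num_adde_defr.
  - apply: cvg_EFin; first exact: nearW.
    by rewrite -[X in _ --> X](mulr0 (- s ^+ 2)%R); apply: cvgM; [exact: cvg_cst|exact: cn].
  - by apply: cvgeZl.
apply: (cvg_unique (@ereal_hausdorff R) _ c1').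
by move: c1; rewrite -cvg_shiftS.
Qed.

(** The cross term [2 p q x] has no constant sign. By symmetry of the density the integral is
    unchanged when [q] becomes [- q], and adding the two versions cancels the cross term, so only
    nonnegative integrands occur. *)
Lemma integral_sqr_affine_normal_prob (s p q : R) : (s != 0)%R ->
  \int[normal_prob 0%R s]_x ((p + q * x) ^+ 2)%:E =
  (p ^+ 2 + q ^+ 2 * s ^+ 2)%:E.
Proof.
move=> s0; set f := normal_pdf 0%R s.
have cf : continuous f by exact: continuous_normal_pdf.
have f0 x : (0 <= f x)%R by exact: normal_pdf_ge0.
have fN x : f (- x)%R = f x by rewrite /f normal_pdfE// /normal_fun !subr0 sqrrN.
have cX2 : continuous (fun x : R => x ^+ 2 * f x)%R.
  by move=> x; apply: cvgM; [exact: exprn_continuous|exact: cf].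
have ca (r : R) : continuous (fun x : R => (p + r * x) ^+ 2 * f x)%R.
  move=> x; apply: cvgM; last exact: cf.
  apply: (@continuous_comp _ _ _ (fun x : R => p + r * x)%R (fun x => x ^+ 2)%R);
    last exact: exprn_continuous.
  apply: cvgD; first exact: cvg_cst.
  by apply: cvgM; [exact: cvg_cst|exact: cvg_id].
have even_fold (g : R -> R) : (forall x, (0 <= g x)%R) -> continuous g ->
    (forall x, g (- x)%R = g x) -> \int[mu]_x (g x)%:E =
    \int[mu]_(x in `[0%R, +oo[) (g x)%:E + \int[mu]_(x in `[0%R, +oo[) (g x)%:E.
  move=> g0 cg gN; rewrite ge0_integralT_fold//; congr (_ + _).
  by apply: eq_integral => x _; rewrite gN.
have x2E : \int[mu]_x (x ^+ 2 * f x)%:E = (s ^+ 2)%:E.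
  rewrite even_fold//; last 2 first.
  - by move=> x; rewrite mulr_ge0 ?sqr_ge0.
  - by move=> x; rewrite sqrrN fN.
  rewrite integral_sqr_normal_pdf_0y//.
  have A0 : 0 <= \int[mu]_(x in `[0%R, +oo[) (f x)%:E.
    by apply: integral_ge0 => x _; rewrite lee_fin.
  rewrite -(ge0_muleDr _ A0 A0).
  by rewrite -(even_fold f f0 cf fN) integral_normal_pdf mule1.
set c := (p ^+ 2 + q ^+ 2 * s ^+ 2)%R.
rewrite ge0_integral_normal_prob; last 2 first.
  by move=> x; rewrite lee_fin sqr_ge0.
  apply/measurable_EFinP; apply: measurable_funX; exact: measurable_funD.
set I := LHS.
(* [I] is not yet known to be finite. As [c] is real, this equation rules out the infinite values
   and then gives [I = c]. *)
suff : I + I = c%:E + c%:E.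
  move: I c => [r| |] // c; rewrite -!EFinD => -[rc]; congr EFin.
  have : (r *+ 2 = c *+ 2)%R by rewrite !mulr2n.
  by move=> /eqP; rewrite eqrMn2r /= => /eqP.
have IE : I = \int[mu]_x ((p + q * x) ^+ 2 * f x)%:E.
  by apply: eq_integral => x _; rewrite EFinM.
have aff_ge0 r x : (0 <= (p + r * x) ^+ 2 * f x)%R by rewrite mulr_ge0 ?sqr_ge0.
have IN : I = \int[mu]_x ((p + - q * x) ^+ 2 * f x)%:E.
  rewrite IE -(ge0_integralT_oppr _ (aff_ge0 q) (ca q)).
  by apply: eq_integral => x _; rewrite fN mulrN mulNr.
have mca (r : R) : measurable_fun [set: R] (fun x : R => ((p + r * x) ^+ 2 * f x)%:E).
  by apply/measurable_EFinP; exact: continuous_measurable_fun (ca r).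
have mf : measurable_fun [set: R] (fun x : R => (f x)%:E).
  by apply/measurable_EFinP; exact: continuous_measurable_fun cf.
have mX2 : measurable_fun [set: R] (fun x : R => (x ^+ 2 * f x)%:E).
  by apply/measurable_EFinP; exact: continuous_measurable_fun cX2.
rewrite {1}IE IN -ge0_integralD//; last 4 first.
- by move=> x _; rewrite lee_fin.
- exact: mca.
- by move=> x _; rewrite lee_fin.
- exact: mca.
rewrite [LHS](_ : _ = \int[mu]_x ((p ^+ 2 *+ 2)%:E * (f x)%:E +
    (q ^+ 2 *+ 2)%:E * (x ^+ 2 * f x)%:E)); last first.
  by apply: eq_integral => x _; rewrite -!EFinM -!EFinD; congr EFin; ring.
rewrite ge0_integralD//=; last 4 first.
- by move=> x _; rewrite -EFinM lee_fin mulr_ge0 ?mulrn_wge0 ?sqr_ge0.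
- exact: emeasurable_funM.
- by move=> x _; rewrite -EFinM lee_fin mulr_ge0 ?mulrn_wge0 ?(mulr_ge0 (sqr_ge0 _)) ?sqr_ge0.
- exact: emeasurable_funM.
rewrite !ge0_integralZl ?lee_fin ?mulrn_wge0 ?sqr_ge0//; last 2 first.
- by move=> x _; rewrite lee_fin mulr_ge0 ?sqr_ge0.
- by move=> x _; rewrite lee_fin.
rewrite x2E integral_normal_pdf mule1 -!EFinM -!EFinD; congr EFin.
by rewrite /c; ring.
Qed.

(* [normal_prob] lives on [measurableTypeR R] while the law of a real random
   variable lives on [R]; the two measurable structures share their measurable
   sets but not their displays, whence the pushforward by the identity. *)
Lemma integral_sqr_affine_normal_law (m : probability R R) (s p q : R) :
  (s != 0)%R -> (forall A, measurable A -> m A = normal_prob 0%R s A) ->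
  \int[m]_x ((p + q * x) ^+ 2)%:E = (p ^+ 2 + q ^+ 2 * s ^+ 2)%:E.
Proof.
move=> s0 mE; rewrite -integral_sqr_affine_normal_prob//.
pose idR (x : measurableTypeR R) : R := x.
have midR : measurable_fun [set: measurableTypeR R] idR.
  by move=> _ A mA; rewrite setTI.
pose m' := pushforward (normal_prob 0%R s) idR : {measure set R -> \bar R}.
rewrite (eq_measure_integral (m' midR)); last by move=> A mA _; exact: mE.
rewrite /m' /= ge0_integral_pushforward//.
  by apply/measurable_EFinP; apply: measurable_funX; exact: measurable_funD.
by move=> x _; rewrite lee_fin sqr_ge0.
Qed.

End normal_moments.

(** * Second moment of an affine function of a Poisson variable *)

Section poisson_moments.
Context (R : realType).

Lemma cvg_series_poisson_pmf (a : R) : 0 < a ->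
  series (poisson_pmf a) @ \oo --> (1 : R).
Proof.
move=> a0.
have -> : series (poisson_pmf a) = (fun n => series (exp_coeff a) n * expR (- a)).
  apply/funext => n; rewrite /series/= mulr_suml; apply: eq_bigr => i _.
  by rewrite /poisson_pmf a0.
rewrite -(@expRxMexpNx_1 _ a).
by apply: cvgM; [exact: is_cvg_series_exp_coeff|exact: cvg_cst].
Qed.

Lemma poisson_pmfS (a : R) k : 0 < a ->
  k.+1%:R * poisson_pmf a k.+1 = a * poisson_pmf a k.
Proof.
move=> a0; rewrite /poisson_pmf a0 factS natrM exprS.
have : k.+1%:R != 0 :> R by rewrite pnatr_eq0.
have : k`!%:R != 0 :> R by rewrite pnatr_eq0 -lt0n fact_gt0.
by move=> ? ?; field; apply/andP.
Qed.

(** The square is expanded in the factorial moments of order 0, 1 and 2. By [poisson_pmfS] and a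
    shift of index, each is [a] times the previous one, so they equal 1, [a] and [a^2]. *)
Lemma cvg_series_poisson_sqr_affine (a p q : R) : 0 < a ->
  series (fun k => (p + q * k%:R) ^+ 2 * poisson_pmf a k) @ \oo -->
  (p + q * a) ^+ 2 + q ^+ 2 * a.
Proof.
move=> a0; set e := poisson_pmf a.
have s0 : series e @ \oo --> (1 : R) by exact: cvg_series_poisson_pmf.
have s1 : series (fun k => k%:R * e k) @ \oo --> a.
  suff : (fun n => series (fun k => k%:R * e k) n.+1) @ \oo --> a.
    by rewrite cvg_shiftS.
  rewrite (_ : (fun n => _) = (fun n => a * series e n)).
    by rewrite -{2}(mulr1 a); apply: cvgM; [exact: cvg_cst|exact: s0].
  apply/funext => n /=; rewrite /series/= big_nat_recl//= mul0r add0r mulr_sumr.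
  by apply: eq_bigr => i _; exact: poisson_pmfS.
(* The truncated predecessor at [k = 0] is harmless: the factor [k] vanishes there. *)
have s2 : series (fun k => k%:R * k.-1%:R * e k) @ \oo --> a ^+ 2.
  suff : (fun n => series (fun k => k%:R * k.-1%:R * e k) n.+1) @ \oo --> a ^+ 2.
    by rewrite cvg_shiftS.
  rewrite (_ : (fun n => _) = (fun n => a * series (fun k => k%:R * e k) n)).
    by rewrite expr2; apply: cvgM; [exact: cvg_cst|exact: s1].
  apply/funext => n /=; rewrite /series/= big_nat_recl//= !mul0r add0r mulr_sumr.
  apply: eq_bigr => i _.
  by rewrite mulrAC poisson_pmfS// mulrAC mulrA.
(* The coefficients come from [k^2 = k (k - 1) + k]. *)
rewrite (_ : series _ = (fun n => p ^+ 2 * series e n +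
    (2 * p * q + q ^+ 2) * series (fun k => k%:R * e k) n +
    q ^+ 2 * series (fun k => k%:R * k.-1%:R * e k) n)); last first.
  apply/funext => n; rewrite /series/= !mulr_sumr -!big_split/=.
  apply: eq_bigr => -[|i] _; first by rewrite /= !mul0r !mulr0 !addr0.
  by rewrite /= -natr1; ring.
rewrite (_ : (_ + _ * _) ^+ 2 + _ = p ^+ 2 * 1 + (2 * p * q + q ^+ 2) * a +
    q ^+ 2 * a ^+ 2); last by ring.
by apply: cvgD; first apply: cvgD; apply: cvgM => //; exact: cvg_cst.
Qed.

Lemma cvg_eseries_EFin (u : nat -> R) (l : R) :
  series u @ \oo --> l -> (\sum_(0 <= k <oo) (u k)%:E)%E = l%:E.
Proof.
move=> ul; apply/cvg_lim => //.
under eq_fun do rewrite sumEFin.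
by apply: cvg_EFin; [exact: nearW|exact: ul].
Qed.

(** The definition of a Poisson process prescribes only the masses of the naturals. As these sum to
    1, the complement is a null set and the integral becomes a series over the atoms. *)
Lemma ge0_integral_nat_supported (m : probability R R) (pmf : nat -> R)
    (f : R -> \bar R) :
  (forall k, m [set k%:R] = (pmf k)%:E) -> series pmf @ \oo --> (1 : R) ->
  (forall x, 0 <= f x)%E -> measurable_fun [set: R] f ->
  (\int[m]_x f x = \sum_(0 <= k <oo) (f k%:R * (pmf k)%:E))%E.
Proof.
move=> mk s1 f0 mf.
pose F (k : nat) : set R := [set k%:R].
have mF k : measurable (F k) by exact: measurable_set1.
have tF : trivIset setT F.
  apply/trivIsetP => i j _ _ ij; apply/seteqP; split => // x [] /= -> /eqP.
  by rewrite eqr_nat (negbTE ij).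
have mU : measurable (\bigcup_k F k) by exact: bigcupT_measurable.
have mU1 : m (\bigcup_k F k) = 1%E.
  rewrite measure_bigcup//= (eq_eseriesr (fun k _ => mk k)).
  rewrite (eq_eseriesl (Q := xpredT)); last by move=> ?; rewrite in_setT.
  exact: cvg_eseries_EFin.
have mC0 : m (~` \bigcup_k F k) = 0%E by rewrite probability_setC// mU1 subee.
rewrite -(setUv (\bigcup_k F k)) ge0_integral_setU//=; last 3 first.
- exact: measurableC.
- by rewrite setUv.
- exact/disj_setPCl.
rewrite [X in (_ + X)%E](_ : _ = 0%E) ?adde0; last first.
  apply: null_set_integral => //; first exact: measurableC.
  exact: measurable_funTS.
rewrite ge0_integral_bigcup//; last exact: measurable_funTS.
apply: eq_eseriesr => k _.
rewrite (eq_integral (cst (f k%:R))); last by move=> x; rewrite inE /F /= => ->.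
by rewrite integral_cst//= mk.
Qed.

Lemma integral_sqr_affine_poisson (m : probability R R) (a p q : R) : 0 < a ->
  (forall k, m [set k%:R] = (poisson_pmf a k)%:E) ->
  (\int[m]_x ((p + q * x) ^+ 2)%:E = ((p + q * a) ^+ 2 + q ^+ 2 * a)%:E)%E.
Proof.
move=> a0 mk.
rewrite (@ge0_integral_nat_supported m (poisson_pmf a))//.
- under eq_eseriesr do rewrite -EFinM.
  exact/cvg_eseries_EFin/cvg_series_poisson_sqr_affine.
- exact: cvg_series_poisson_pmf.
- by move=> x; rewrite lee_fin sqr_ge0.
- apply/measurable_EFinP; apply: measurable_funX; exact: measurable_funD.
Qed.

End poisson_moments.

(** * Independence of the current state from future noise *)

Section independence_lemmas.
Context d (T : measurableType d) (R : realType) (P : probability T R).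
Local Open Scope ereal_scope.

(* Rectangles form a pi-system generating the product sigma-algebra. *)
Lemma independent_pair_event d1 d2 (T1 : measurableType d1)
    (T2 : measurableType d2) (U : T -> T1) (V : T -> T2) (F : set T) :
  measurable_fun [set: T] U -> measurable_fun [set: T] V -> measurable F ->
  (forall A B, measurable A -> measurable B ->
    P (U @^-1` A `&` V @^-1` B `&` F) = P (U @^-1` A `&` V @^-1` B) * P F) ->
  forall S, measurable S ->
    P ((fun w => (U w, V w)) @^-1` S `&` F) =
    P ((fun w => (U w, V w)) @^-1` S) * P F.
Proof.
move=> mU mV mF H S mS.
have mUV : measurable_fun [set: T] (fun w => (U w, V w)).
  exact: measurable_fun_pair.
have PFge0 : (0 <= fine (P F))%R by rewrite fine_ge0.
pose m1 := pushforward (mrestr P mF) (fun w => (U w, V w))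
  : {measure set (T1 * T2)%type -> \bar R}.
pose m2 := mscale (NngNum PFge0) (pushforward P (fun w => (U w, V w)))
  : {measure set (T1 * T2)%type -> \bar R}.
suff : m1 mUV S = m2 mUV S.
  rewrite /m1 /m2 /= /pushforward /mrestr /mscale/= fineK ?fin_num_measure//.
  by rewrite muleC.
apply: (measure_unique [set A `*` B | A in measurable & B in measurable]
  (fun=> setT)) => //.
- exact: measurable_prod_measurableType.
- move=> _ _ [A1 mA1 [B1 mB1 <-]] [A2 mA2 [B2 mB2 <-]]; rewrite -setXI.
  by exists (A1 `&` A2); [exact: measurableI|exists (B1 `&` B2) => //; exact: measurableI].
- by move=> _; exists setT => //; exists setT => //; rewrite setXTT.
- by rewrite bigcup_const.
- move=> _ [A mA [B mB <-]].
  rewrite /m1 /m2 /= /pushforward /mrestr /mscale/= fineK ?fin_num_measure// muleC.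
  exact: H.
- move=> _; rewrite /m1 /= /pushforward /mrestr /= preimage_setT setTI.
  by rewrite ltey_eq fin_num_measure.
Qed.

(** The product rule on rectangles identifies the joint law with the product of the two laws;
    Tonelli then needs nonnegativity only. *)
Lemma ge0_integral_independent_pair d1 d2 (T1 : measurableType d1)
    (T2 : measurableType d2) (U : {mfun T >-> T1}) (V : {mfun T >-> T2})
    (f : T1 * T2 -> \bar R) :
  (forall A B, measurable A -> measurable B ->
    P (U @^-1` A `&` V @^-1` B) = P (U @^-1` A) * P (V @^-1` B)) ->
  (forall z, 0 <= f z) -> measurable_fun [set: T1 * T2] f ->
  \int[P]_w f (U w, V w) =
  \int[distribution P U]_x \int[distribution P V]_y f (x, y).
Proof.
move=> H f0 mf.
have mUV : measurable_fun [set: T] (fun w => (U w, V w)).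
  exact: measurable_fun_pair.
pose m := pushforward P (fun w => (U w, V w))
  : {measure set (T1 * T2)%type -> \bar R}.
transitivity (\int[m mUV]_z f z).
  by rewrite /m /= ge0_integral_pushforward.
transitivity (\int[distribution P U \x distribution P V]_z f z); last first.
  exact: (fubini_tonelli1 _ mf f0).
apply: eq_measure_integral => S mS _; apply/esym.
by apply: product_measure_unique.
Qed.

Definition cylinder (Z : nat -> T -> R) n (C : nat -> set R) k : set T :=
  \big[setI/setT]_(i < k) Z (n + i)%N @^-1` C i.

(** The value that independence predicts for the probability of the cylinder. *)
Definition cylinder_prob (Z : nat -> T -> R) n (C : nat -> set R) k : \bar R :=
  \prod_(i < k) P (Z (n + i)%N @^-1` C i).

(** Prepending a constraint lets a cylinder from [n] be split into the noise at [n] and a cylinder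
    from [n.+1]. The choice [B = setT] leaves the noise at [n] free. *)
Definition scons (B : set R) (C : nat -> set R) i :=
  if i is j.+1 then C j else B.

Lemma cylinderS Z n B C k : cylinder Z n (scons B C) k.+1 =
  Z n @^-1` B `&` cylinder Z n.+1 C k.
Proof.
rewrite /cylinder big_ord_recl/= addn0; congr (_ `&` _).
by apply: eq_bigr => i _; rewrite /bump /= add1n addnS.
Qed.

Lemma cylinder_probS Z n B C k : cylinder_prob Z n (scons B C) k.+1 =
  P (Z n @^-1` B) * cylinder_prob Z n.+1 C k.
Proof.
rewrite /cylinder_prob big_ord_recl/= addn0; congr (_ * _).
by apply: eq_bigr => i _; rewrite /bump /= add1n addnS.
Qed.

Lemma measurable_cylinder (Z : nat -> {mfun T >-> R}) n C k :
  (forall i, measurable (C i)) -> measurable (cylinder Z n C k).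
Proof.
by move=> mC; apply: bigsetI_measurable => i _; exact: measurable_funPTI.
Qed.

(** Total factorisation is required, so [B = setT] yields independence of the noises among
    themselves. A common length [k] loses nothing, as shorter constraints can be padded with
    [setT]. *)
Definition independent_of_future (Z1 Z2 : nat -> T -> R) n (U : T -> R) :=
  forall (B : set R) (C D : nat -> set R) k, measurable B ->
    (forall i, measurable (C i)) -> (forall i, measurable (D i)) ->
    P (U @^-1` B `&` (cylinder Z1 n C k `&` cylinder Z2 n D k)) =
    P (U @^-1` B) * (cylinder_prob Z1 n C k * cylinder_prob Z2 n D k).

Section future.
Variables (Z1 Z2 : nat -> {mfun T >-> R}) (n : nat) (U : {mfun T >-> R}).
Hypothesis H : independent_of_future Z1 Z2 n U.

Lemma measurable_scons B C : measurable B -> (forall i, measurable (C i)) ->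
  forall i, measurable (scons B C i).
Proof. by move=> mB mC [|i] /=. Qed.

Lemma independent_of_future_noise B C : measurable B -> measurable C ->
  P (Z1 n @^-1` B `&` Z2 n @^-1` C) = P (Z1 n @^-1` B) * P (Z2 n @^-1` C).
Proof.
move=> mB mC.
have := H setT (fun=> B) (fun=> C) 1%N measurableT (fun=> mB) (fun=> mC).
rewrite preimage_setT setTI probability_setT mul1e.
by rewrite /cylinder /cylinder_prob !big_ord1 addn0.
Qed.

(** For a rectangle, compare the hypothesis with the noises at [n] constrained and with them left
    free. [independent_pair_event] then passes to every measurable set of the plane. *)
Lemma independent_of_future_joint A B C D k : measurable A -> measurable B ->
  (forall i, measurable (C i)) -> (forall i, measurable (D i)) ->
  P ((fun w => (Z1 n w, Z2 n w)) @^-1` A `&`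
     (U @^-1` B `&` (cylinder Z1 n.+1 C k `&` cylinder Z2 n.+1 D k))) =
  P ((fun w => (Z1 n w, Z2 n w)) @^-1` A) *
  P (U @^-1` B `&` (cylinder Z1 n.+1 C k `&` cylinder Z2 n.+1 D k)).
Proof.
move=> mA mB mC mD.
have mcyl : measurable (cylinder Z1 n.+1 C k `&` cylinder Z2 n.+1 D k).
  by apply: measurableI; exact: measurable_cylinder.
apply: independent_pair_event => //.
  by apply: measurableI => //; exact: measurable_funPTI.
move=> {A mA} A1 A2 mA1 mA2.
have mA1C := measurable_scons A1 C mA1 mC.
have mA2D := measurable_scons A2 D mA2 mD.
have mTC := measurable_scons setT C measurableT mC.
have mTD := measurable_scons setT D measurableT mD.
have := H B (scons A1 C) (scons A2 D) k.+1 mB mA1C mA2D.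
have := H B (scons setT C) (scons setT D) k.+1 mB mTC mTD.
rewrite !cylinderS !cylinder_probS !preimage_setT !setTI probability_setT !mul1e.
rewrite independent_of_future_noise// => -> E.
rewrite [RHS](_ : _ = P (U @^-1` B) *
  (P (Z1 n @^-1` A1) * cylinder_prob Z1 n.+1 C k *
   (P (Z2 n @^-1` A2) * cylinder_prob Z2 n.+1 D k))); last first.
  by rewrite muleCA; congr *%E; rewrite muleACA.
rewrite -E; congr (P _).
by rewrite [LHS]setICA; congr (_ `&` _); rewrite setIACA.
Qed.

Lemma independent_of_future_pair A B : measurable A -> measurable B ->
  P (U @^-1` B `&` (fun w => (Z1 n w, Z2 n w)) @^-1` A) =
  P (U @^-1` B) * P ((fun w => (Z1 n w, Z2 n w)) @^-1` A).
Proof.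
move=> mA mB.
have := independent_of_future_joint A B (fun=> setT) (fun=> setT) 0%N
  mA mB (fun=> measurableT) (fun=> measurableT).
by rewrite /cylinder !big_ord0 !setIT setIC muleC.
Qed.

(** Induction step of the scheme: the next state is a function of the pair formed by [U] and the
    current noise. By [independent_pair_event] it suffices to test rectangles, where the noise
    splits off first and [U] afterwards. *)
Lemma independent_of_futureS (g : R * (R * R) -> R) :
  measurable_fun [set: R * (R * R)] g ->
  independent_of_future Z1 Z2 n.+1 (fun w => g (U w, (Z1 n w, Z2 n w))).
Proof.
move=> mg B C D k mB mC mD.
have mTC := measurable_scons setT C measurableT mC.
have mTD := measurable_scons setT D measurableT mD.
have UF A (mA : measurable A) :
    P (U @^-1` A `&` (cylinder Z1 n.+1 C k `&` cylinder Z2 n.+1 D k)) =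
    P (U @^-1` A) * (cylinder_prob Z1 n.+1 C k * cylinder_prob Z2 n.+1 D k).
  have := H A (scons setT C) (scons setT D) k.+1 mA mTC mTD.
  by rewrite !cylinderS !cylinder_probS !preimage_setT !setTI probability_setT !mul1e.
(* With [U] unconstrained, [UF] turns the predicted product into the probability of the future
   event. *)
have := UF setT measurableT.
rewrite preimage_setT setTI probability_setT mul1e => <-.
have mF : measurable (cylinder Z1 n.+1 C k `&` cylinder Z2 n.+1 D k).
  by apply: measurableI; exact: measurable_cylinder.
have mV : measurable_fun [set: T] (fun w => (Z1 n w, Z2 n w)).
  exact: measurable_fun_pair.
apply: (@independent_pair_event _ _ _ _ U (fun w => (Z1 n w, Z2 n w)) _ _ _ _
  _ (g @^-1` B)) => //.
- move=> A1 A2 mA1 mA2.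
  have := UF A1 mA1; have := UF setT measurableT.
  rewrite preimage_setT setTI probability_setT mul1e => <- E.
  rewrite independent_of_future_pair// -setIA setICA.
  by rewrite independent_of_future_joint// E muleA [in RHS](muleC (P (U @^-1` _))).
- by rewrite -[X in measurable X]setTI; exact: mg.
Qed.

End future.

End independence_lemmas.

Arguments cylinder {d T R} Z n C k.
Arguments cylinder_prob {d T R} P Z n C k.
Arguments independent_of_future {d T R} P Z1 Z2 n U.

(** * Product rules for pairs, triples and cylinders *)

Lemma big_fset_fin (I : finType) (V : Type) (idx : V) (op : Monoid.com_law idx)
    (J : {fset I}) (F : I -> V) :
  \big[op/idx]_(i <- J) F i = \big[op/idx]_i (if i \in J then F i else idx).
Proof.
rewrite -big_mkcond/= -[RHS]big_filter; apply: perm_big.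
apply: uniq_perm => [||i]; first exact: fset_uniq.
  by rewrite filter_uniq// index_enum_uniq.
by rewrite mem_filter mem_index_enum andbT.
Qed.

Section independence_of_tuples.
Context d (T : measurableType d) (R : realType) (P : probability T R).
Local Open Scope ereal_scope.

(** Any subfamily can be completed by [setT], which changes neither the intersection nor the
    product, so the rule for the full family suffices. *)
Lemma mutually_independent_finP (I : finType) (F : I -> set_system T) :
  (forall i, F i setT) ->
  mutually_independent P F <->
  forall A : I -> set T, (forall i, F i (A i)) ->
    P (\big[setI/setT]_i A i) = \prod_i P (A i).
Proof.
move=> FT; split=> [H A FA|H J A FA].
  pose J := [fset i in index_enum I]%fset.
  have big_J V (idx : V) (op : Monoid.com_law idx) (f : I -> V) :
      \big[op/idx]_(i <- J) f i = \big[op/idx]_i f i.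
    rewrite big_fset_fin; apply: eq_bigr => i _.
    by rewrite inE /= mem_index_enum.
  have := H J A (fun i _ => FA i).
  by rewrite bigcap_fset !big_J.
rewrite bigcap_fset !big_fset_fin.
pose A' i := if i \in J then A i else setT.
have FA' i : F i (A' i) by rewrite /A'; case: ifPn => // /FA.
rewrite (H A' FA'); apply: eq_bigr => i _; rewrite /A'.
by case: ifPn => //; rewrite probability_setT.
Qed.

Lemma mutually_independent2 (F G : set_system T) : F setT -> G setT ->
  mutually_independent P (tnth [tuple F; G]) ->
  forall A B, F A -> G B -> P (A `&` B) = P A * P B.
Proof.
move=> FT GT /mutually_independent_finP H A B FA GB.
have := H _ (tnth [tuple A; B]).
rewrite !big_ord_recl !big_ord0/= setIT mule1; apply.
- by case=> [[|[|//]] ?].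
- by case=> [[|[|//]] ?].
Qed.

Lemma mutually_independent3P (F G H : set_system T) :
  F setT -> G setT -> H setT ->
  mutually_independent P (tnth [tuple F; G; H]) <->
  forall A B C, F A -> G B -> H C ->
    P (A `&` (B `&` C)) = P A * (P B * P C).
Proof.
move=> FT GT HT; rewrite mutually_independent_finP; last first.
  by case=> [[|[|[|//]]] ?].
split=> [K A B C FA GB HC|K A FA].
  have := K (tnth [tuple A; B; C]).
  rewrite !big_ord_recl !big_ord0/= setIT mule1; apply.
  by case=> [[|[|[|//]]] ?].
rewrite !big_ord_recl !big_ord0/= setIT mule1; apply: K.
- exact: (FA ord0).
- exact: (FA (lift ord0 ord0)).
- exact: (FA (lift ord0 (lift ord0 ord0))).
Qed.

Lemma g_sigma_algebra_preimage_setT (X : T -> R) :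
  g_sigma_algebra_preimage X setT.
Proof. by exists setT => //; rewrite preimage_setT setTI. Qed.

Lemma sigma_process_setT (X : R -> {RV P >-> R}) : sigma_process X setT.
Proof. exact: (@measurableT _ (g_sigma_algebraType _)). Qed.

Lemma independent_RVs_cylinder (Z : nat -> T -> R) C k :
  independent_RVs P Z -> (forall i, measurable (C i)) ->
  P (cylinder Z 0 C k) = cylinder_prob P Z 0 C k.
Proof.
move=> H mC; pose J := [fset i in iota 0 k]%fset.
have big_J V (idx : V) (op : Monoid.com_law idx) (F : nat -> V) :
    \big[op/idx]_(i <- J) F i = \big[op/idx]_(i < k) F i.
  rewrite -(big_mkord xpredT)/index_iota subn0; apply: perm_big.
  by apply: uniq_perm => [||i]; rewrite ?fset_uniq ?iota_uniq// !inE.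
have := H J (fun i => Z i @^-1` C i).
rewrite bigcap_fset !big_J; apply => i _.
by exists (C i) => //; rewrite setTI.
Qed.

(** Equip [T] with the sigma-algebra generated by the process: each [X s] with [s >= 0] is
    measurable for it, hence so are the increments and their cylinders. *)
Lemma sigma_process_cylinder (X : R -> {RV P >-> R}) (t : nat -> R) n C k :
  (forall i, 0 <= t i)%R -> (forall i, measurable (C i)) ->
  sigma_process X (cylinder (fun i => increment X (t i) (t i.+1)) n C k).
Proof.
move=> t0 mC; rewrite /sigma_process.
set G := \bigcup_(t in _) _.
have mX s : (0 <= s)%R ->
    measurable_fun [set: g_sigma_algebraType G] (X s : g_sigma_algebraType G -> R).
  move=> s0 _ B mB; rewrite setTI; apply: sub_sigma_algebra.
  by exists s => //; exists B => //; rewrite setTI.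
apply: (@bigsetI_measurable _ (g_sigma_algebraType G)) => i _.
rewrite -[X in measurable X]setTI.
by apply: measurable_funB => //; exact: mX.
Qed.

Lemma measurable_increment (X : R -> {RV P >-> R}) s t :
  measurable_fun [set: T] (increment X s t).
Proof. exact: measurable_funB. Qed.

HB.instance Definition _ (X : R -> {RV P >-> R}) s t :=
  isMeasurableFun.Build _ _ _ _ (increment X s t) (measurable_increment X s t).

End independence_of_tuples.

(** * Second moment of the scheme *)

Section semi_tamed_scheme.
Context d (T : measurableType d) (R : realType) (P : probability T R).
Variables (W N : R -> {RV P >-> R}) (a b c lambda dt : R).
Hypotheses (hW : brownian_motion W) (lambda_gt0 : 0 < lambda).
Hypotheses (hN : poisson_process lambda N) (dt_gt0 : 0 < dt).

Let dW n : {mfun T >-> R} := increment W (n%:R * dt) (n.+1%:R * dt).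
Let dN n : {mfun T >-> R} := increment N (n%:R * dt) (n.+1%:R * dt).

Let time_ge0 n : 0 <= n%:R * dt.
Proof. by rewrite mulr_ge0// ltW. Qed.

Let time_lt n : n%:R * dt < n.+1%:R * dt.
Proof. by rewrite ltr_pM2r// ltr_nat. Qed.

Let timeB n : n.+1%:R * dt - n%:R * dt = dt.
Proof. by rewrite -mulrBl -natrB// subSnn mul1r. Qed.

Let time_homo : {homo (fun n : nat => n%:R * dt) : i j / (i <= j)%N >-> i <= j}.
Proof. by move=> i j ij; rewrite ler_pM2r// ler_nat. Qed.

Let Y := semi_tamed_linear a b c dt W N.

(** Base of the induction: independence of [X0], [W] and [N] separates the three events, and
    independence of increments factors each cylinder. *)
Lemma independent_of_future_initial_value (X0 : {RV P >-> R}) :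
  initial_value W N X0 -> independent_of_future P dW dN 0 X0.
Proof.
move=> [_]; rewrite mutually_independent3P; last 3 first.
- exact: g_sigma_algebra_preimage_setT.
- exact: sigma_process_setT.
- exact: sigma_process_setT.
move=> H B C D k mB mC mD; rewrite H.
- have [_ incW _ _] := hW; have [_ incN _ _] := hN.
  by rewrite !independent_RVs_cylinder//;
    [exact: incN time_homo|exact: incW time_homo].
- by exists B => //; rewrite setTI.
- exact: (sigma_process_cylinder _ _ _ _ W (fun n => n%:R * dt)).
- exact: (sigma_process_cylinder _ _ _ _ N (fun n => n%:R * dt)).
Qed.

(** Events of a constant variable are empty or everything, so only the independence of [W] and [N]
    is at stake. *)
Lemma initial_value_cst1 :
  mutually_independent P (tnth [tuple sigma_process W; sigma_process N]) ->
  initial_value W N (cst 1).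
Proof.
move=> hWN; split.
  rewrite unlock /= (eq_integral (cst 1%E)); last first.
    by move=> w _; rewrite /= normr1 expr1n.
  by rewrite integral_cst//= mul1e probability_setT ltry.
rewrite mutually_independent3P; [|exact: g_sigma_algebra_preimage_setT|
  exact: sigma_process_setT|exact: sigma_process_setT].
move=> _ B C [A mA <-] WB NC; rewrite setTI.
rewrite -(mutually_independent2 _ _ _ _ _ _ (sigma_process_setT _ _ _ _ W)
  (sigma_process_setT _ _ _ _ N) hWN _ _ WB NC).
have [A1|A1] := pselect (A 1).
  rewrite (_ : cst 1 @^-1` A = setT) ?setTI ?probability_setT ?mul1e//.
  by apply/seteqP; split => // w _.
rewrite (_ : cst 1 @^-1` A = set0) ?set0I ?measure0 ?mul0e//.
by apply/seteqP; split => // w /A1.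
Qed.

Definition amplification : R :=
  (1 + (a + lambda * c) * dt) ^+ 2 + b ^+ 2 * dt + c ^+ 2 * (lambda * dt).

Lemma expectation_step_factor n :
  (forall A B, measurable A -> measurable B ->
    P (dW n @^-1` A `&` dN n @^-1` B) = P (dW n @^-1` A) * P (dN n @^-1` B))%E ->
  (\int[P]_w ((1 + a * dt + b * dW n w + c * dN n w) ^+ 2)%:E =
   amplification%:E)%E.
Proof.
move=> ind.
have lawW (A : set R) : measurable A ->
    distribution P (dW n) A = normal_prob 0 (Num.sqrt dt) A.
  have [_ _ gauss _] := hW.
  by move=> mA; have := gauss _ _ (time_ge0 n) (time_lt n) A mA; rewrite timeB.
have lawN k : distribution P (dN n) [set k%:R] = (poisson_pmf (lambda * dt) k)%:E.
  have [_ _ pois _] := hN.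
  by have := pois _ _ (time_ge0 n) (time_lt n) k; rewrite timeB.
(* The Poisson variable comes first, so that the inner integral is the Gaussian one; it leaves a
   squared affine function of the Poisson variable plus a constant. *)
pose f (z : R * R) : \bar R := ((1 + a * dt + b * z.2 + c * z.1) ^+ 2)%:E.
have mf : measurable_fun [set: R * R] f.
  apply/measurable_EFinP; apply: measurable_funX; apply: measurable_funD.
    apply: measurable_funD => //.
    by apply: measurable_funM => //; exact: measurable_snd.
  by apply: measurable_funM => //; exact: measurable_fst.
rewrite -[LHS]/(\int[P]_w f (dN n w, dW n w))%E.
rewrite ge0_integral_independent_pair//; last 2 first.
- by move=> A B mA mB; rewrite setIC ind// muleC.
- by move=> z; rewrite lee_fin sqr_ge0.
have inner m : (\int[distribution P (dW n)]_w f (m, w) =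
    ((1 + a * dt + c * m) ^+ 2)%:E + (b ^+ 2 * dt)%:E)%E.
  have := integral_sqr_affine_normal_law _ (distribution P (dW n)) _
    (1 + a * dt + c * m) b _ lawW.
  rewrite sqr_sqrtr ?(ltW dt_gt0)// EFinD => <-.
    by apply: eq_integral => w _; congr EFin; rewrite /=; ring.
  by rewrite gt_eqF// sqrtr_gt0.
under eq_integral do rewrite inner.
rewrite ge0_integralD//; last 3 first.
- by move=> m _; rewrite lee_fin sqr_ge0.
- apply/measurable_EFinP; apply: measurable_funX; exact: measurable_funD.
- by move=> m _; rewrite lee_fin mulr_ge0 ?sqr_ge0// ltW.
rewrite (integral_sqr_affine_poisson _ _ (lambda * dt))//; last exact: mulr_gt0.
rewrite integral_cst//= probability_setT mule1 -EFinD; congr EFin.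
by rewrite /amplification; ring.
Qed.

(** Measurability is carried along in the induction because the independence step needs the state to
    be a bundled measurable function. *)
Lemma semi_tamed_linear_state (X0 : {RV P >-> R}) n : initial_value W N X0 ->
  measurable_fun [set: T] (Y X0 n) /\ independent_of_future P dW dN n (Y X0 n).
Proof.
move=> hX0; elim: n => [|n [mY IH]].
  by split => //; exact: independent_of_future_initial_value.
pose g (z : R * (R * R)) : R :=
  z.1 + a * z.1 * dt + b * z.1 * z.2.1 + c * z.1 * z.2.2.
have mg : measurable_fun [set: R * (R * R)] g.
  have m1 : measurable_fun [set: R * (R * R)] (fun z => z.1).
    exact: measurable_fst.
  have m21 : measurable_fun [set: R * (R * R)] (fun z => z.2.1).
    exact: (measurableT_comp measurable_fst measurable_snd).
  have m22 : measurable_fun [set: R * (R * R)] (fun z => z.2.2).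
    exact: (measurableT_comp measurable_snd measurable_snd).
  by do ?apply: measurable_funD; do ?apply: measurable_funM.
pose Yn : {mfun T >-> R} := HB.pack (Y X0 n) (isMeasurableFun.Build _ _ _ _ _ mY).
split; last exact: (independent_of_futureS _ _ _ _ dW dN n Yn IH g mg).
have mV : measurable_fun [set: T] (fun w => (Yn w, (dW n w, dN n w))).
  by do 2 apply: measurable_fun_pair => //.
exact: (measurableT_comp mg mV).
Qed.

(** Each step multiplies the second moment by [amplification]: Tonelli separates the state from the
    current noise. The identity is proved in the extended reals, with no appeal to finiteness of the
    moments. *)
Lemma expectation_semi_tamed_sqr (X0 : {RV P >-> R}) n : initial_value W N X0 ->
  ('E_P[fun w => (Y X0 n w ^+ 2)%R] =
   'E_P[fun w => (X0 w ^+ 2)%R] * (amplification ^+ n)%:E)%E.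
Proof.
move=> hX0; elim: n => [|n IH]; first by rewrite expr0 mule1.
have [mY ind] := semi_tamed_linear_state X0 n hX0.
pose Yn : {mfun T >-> R} := HB.pack (Y X0 n) (isMeasurableFun.Build _ _ _ _ _ mY).
have noise := independent_of_future_noise _ _ _ _ dW dN n Yn ind.
have pair := independent_of_future_pair _ _ _ _ dW dN n Yn ind.
have mZ : measurable_fun [set: T] (fun w => (dW n w, dN n w)).
  exact: measurable_fun_pair.
pose Z : {mfun T >-> (R * R)%type} := HB.pack (fun w => (dW n w, dN n w))
  (isMeasurableFun.Build _ _ _ _ _ mZ).
pose g (z : R * R) : \bar R := ((1 + a * dt + b * z.1 + c * z.2) ^+ 2)%:E.
have mg : measurable_fun [set: R * R] g.
  apply/measurable_EFinP; apply: measurable_funX; apply: measurable_funD.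
    apply: measurable_funD => //.
    by apply: measurable_funM => //; exact: measurable_fst.
  by apply: measurable_funM => //; exact: measurable_snd.
have g0 z : (0 <= g z)%E by rewrite lee_fin sqr_ge0.
have gE : (\int[distribution P Z]_z g z = amplification%:E)%E.
  by rewrite ge0_integral_distribution//= -(expectation_step_factor n noise).
have msqr : measurable_fun [set: R] (fun y : R => (y ^+ 2)%:E).
  by apply/measurable_EFinP; exact: measurable_funX.
rewrite exprSr EFinM muleA -IH unlock.
pose f (z : R * (R * R)) : \bar R := ((z.1 ^+ 2)%:E * g z.2)%E.
rewrite [LHS](_ : _ = \int[P]_w f (Yn w, Z w))%E; last first.
  apply: eq_integral => w _; rewrite /f /g /= -EFinM; congr EFin.
  by rewrite /Y /= -/Y /dW /dN; ring.
rewrite ge0_integral_independent_pair//; last 3 first.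
- by move=> A B mA mB; rewrite pair.
- by move=> z; rewrite /f mule_ge0// lee_fin sqr_ge0.
- apply: emeasurable_funM.
    exact: (measurableT_comp msqr measurable_fst).
  exact: (measurableT_comp mg measurable_snd).
(* For a fixed state [y], integrating over the noise gives [y^2] times the constant
   [amplification]. *)
under eq_integral => y _.
  rewrite /f /= ge0_integralZl ?lee_fin ?sqr_ge0// gE; over.
rewrite ge0_integralZr//; last 2 first.
- by move=> y _; rewrite lee_fin sqr_ge0.
- by rewrite -gE; exact: integral_ge0.
by congr (_ * _)%E; rewrite ge0_integral_distribution//= => y; rewrite lee_fin sqr_ge0.
Qed.

End semi_tamed_scheme.

(** * The stability criterion *)

Lemma amplification_lt1 (R : realType) (a b c lambda dt : R) : 0 < lambda ->
  2 * a + b ^+ 2 + lambda * c * (2 + c) < 0 -> 0 < dt ->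
  (amplification R a b c lambda dt < 1) =
  (dt < - (2 * a + b ^+ 2 + lambda * c * (2 + c)) / (a + lambda * c) ^+ 2).
Proof.
move=> lambda0 l0 dt0.
(* Here [l = 2 (a + lambda c) + b^2 + lambda c^2], which would be nonnegative if the drift vanished.
   This excludes a division by zero in the bound. *)
have drift_neq0 : a + lambda * c != 0.
  apply: contraTneq l0 => ac0; rewrite -leNgt.
  rewrite (_ : _ + _ = 2 * (a + lambda * c) + b ^+ 2 + lambda * c ^+ 2); last by ring.
  by rewrite ac0 mulr0 add0r addr_ge0 ?sqr_ge0// mulr_ge0 ?sqr_ge0// ltW.
rewrite ltr_pdivlMr ?exprn_even_gt0//.
rewrite -subr_lt0 -[RHS]subr_lt0 /amplification.
rewrite (_ : _ - 1 = dt * (dt * (a + lambda * c) ^+ 2 -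
  - (2 * a + b ^+ 2 + lambda * c * (2 + c)))); last by ring.
by rewrite pmulr_rlt0.
Qed.

Theorem theorem4p1 (d : measure_display) (T : measurableType d) (R : realType)
    (P : probability T R) (W N : R -> {RV P >-> R}) (a b c lambda dt : R)
    (hW : brownian_motion W) (hlambda : 0 < lambda)
    (hN : poisson_process lambda N)
    (hWN : mutually_independent P
             (tnth [tuple sigma_process W; sigma_process N]))
    (l := 2 * a + b ^+ 2 + lambda * c * (2 + c)) (hl : l < 0) (hdt : 0 < dt) :
  mean_square_stable W N (semi_tamed_linear a b c dt W N) <->
  dt < - l / (a + lambda * c) ^+ 2.
Proof.
set r := amplification R a b c lambda dt.
have r_ge0 : 0 <= r.
  by rewrite /r /amplification !addr_ge0 ?sqr_ge0// ?(mulr_ge0 (sqr_ge0 _))//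
    ?mulr_ge0 ?ltW.
have secondE X0 n : initial_value W N X0 ->
    ('E_P[fun w => (semi_tamed_linear a b c dt W N X0 n w ^+ 2)%R] =
     'E_P[fun w => (X0 w ^+ 2)%R] * (r ^+ n)%:E)%E.
  by move=> hX0; exact: (expectation_semi_tamed_sqr _ _ _ _ W N).
rewrite -amplification_lt1// -/r; split => [stable|r_lt1 X0 hX0].
  have hc := initial_value_cst1 _ _ _ _ W N hWN.
  have := stable (cst 1) hc.
  rewrite (funext (fun n => secondE _ n hc)).
  have -> : 'E_P[fun w => (@cst T R 1 w ^+ 2)%R]%E = 1%E.
    rewrite unlock (eq_integral (cst 1%E)) => [|w _]; last by rewrite /= expr1n.
    by rewrite integral_cst//= mul1e probability_setT.
  under eq_fun do rewrite mul1e.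
  (* If [r >= 1], all powers of [r] are at least 1 and so is their limit, which stability says is
     0. *)
  move=> /fine_cvgP[_ rn0]; rewrite ltNge; apply/negP => r_ge1.
  have : (1 : R) <= 0.
    apply: (closed_cvg (fun x : R => 1 <= x) (@closed_ge R 1) _ _ rn0).
    by apply: nearW => n /=; rewrite exprn_ege1.
  by rewrite ler10.
(* Square integrability makes the initial second moment a real number [m], so the claim becomes the
   real limit of [m * r ^+ n]. *)
have [m mE] : exists m : R, 'E_P[fun w => (X0 w ^+ 2)%R]%E = m%:E.
  have [finX0 _] := hX0.
  exists (fine 'E_P[fun w => (X0 w ^+ 2)%R]); rewrite fineK// ge0_fin_numE.
    rewrite (_ : (fun w => X0 w ^+ 2) = (fun w => `|X0 w| ^+ 2))//.
    by apply/funext => w; rewrite real_normK ?num_real.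
  by apply: expectation_ge0 => w; rewrite sqr_ge0.
under eq_fun do rewrite secondE// mE -EFinM.
apply: cvg_EFin; first exact: nearW.
rewrite -(mulr0 m); apply: cvgM; first exact: cvg_cst.
by apply: cvg_expr; rewrite ger0_norm.
Qed.
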